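(* Let $\mathbb{K}$ be a field and $r\in\mathbb{K}$ invertible, $q:=r-1$. For each partition diagram $\pi$ let $$\eta^{(q)}_\pi:=\sum_{\sigma\ge\pi}r^{l(\sigma)}M_\sigma\in\mathrm{ParQSym},\qquad \kappa^{(q)}_\pi:=\sum_{\sigma\le\pi}(-1)^{l(\sigma)-l(\pi)}r^{-l(\sigma)}H_\sigma\in\mathrm{ParSym}.$$ Then $\{\kappa^{(q)}_\pi\}$ is the basis of $\mathrm{ParSym}$ dual to the basis $\{\eta^{(q)}_\pi\}$ of $\mathrm{ParQSym}$, that is, $\langle\eta^{(q)}_\rho,\kappa^{(q)}_\pi\rangle=\delta_{\rho,\pi}$ for all partition diagrams $\rho,\pi$.
   Context: **Partition diagrams.** A partition diagram of order $k\ge 0$ is a set partition of $\{1,\dots,k,1',\dots,k'\}$; for $k=0$ the only one is the empty diagram $\emptyset$. For $\pi$ of order $k$ and $\rho$ of order $m$, $\pi\otimes\rho$ is the diagram of order $k+m$ whose blocks are the blocks of $\pi$ and the blocks of $\rho$ with labels shifted by $k$ ($i\mapsto i+k$, $i'\mapsto (i+k)'$). If $k,m\ge1$, $\pi\bullet\rho$ is obtained from $\pi\otimes\rho$ by merging the block containing $k'$ with the block containing $(k+1)'$. The empty diagram is the unit for both operations. A diagram is $\otimes$-irreducible (resp. $\bullet$-irreducible) if it is not $\rho\otimes\sigma$ (resp. $\rho\bullet\sigma$) with $\rho,\sigma$ both non-empty. Every non-empty $\pi$ is uniquely $\pi_1\otimes\cdots\otimes\pi_l$ with all $\pi_i$ non-empty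 and $\otimes$-irreducible; $l(\pi):=l$, and $l(\emptyset):=0$. **Refinement.** Every non-empty $\pi$ can be uniquely written $\pi=\pi_1\divideontimes_1\pi_2\divideontimes_2\cdots\divideontimes_{n-1}\pi_n$ with each $\divideontimes_i\in\{\otimes,\bullet\}$ and each $\pi_i$ non-empty and both $\otimes$- and $\bullet$-irreducible (on non-empty diagrams $\otimes$ and $\bullet$ associate with each other). Put $S(\pi)=\{i\in\{1,\dots,n-1\}:\divideontimes_i=\otimes\}$. For non-empty $\pi,\sigma$ write $\pi\sim\sigma$ if their sequences $(\pi_1,\dots,\pi_n)$ and $(\sigma_1,\dots,\sigma_m)$ are equal; $\pi\le\sigma$ if $\pi\sim\sigma$ and $S(\sigma)\subseteq S(\pi)$. The empty diagram is related only to itself, with $\emptyset\le\emptyset$. **Pairing.** $\mathrm{ParSym}$ and $\mathrm{ParQSym}$ are the $\mathbb{K}$-vector spaces with bases $\{H_\pi\}$ and $\{M_\pi\}$ respectively, indexed by all partition diagrams, and $\langle\cdot,\cdot\rangle:\mathrm{ParQSym}\otimes\mathrm{ParSym}\to\mathbb{K}$ is the bilinear form with $\langle M_\rho,H_\pi\rangle=\delta_{\rho,\pi}$. *)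

(* Defs.v *)
From HB Require Import structures.
From mathcomp Require Import all_boot all_order all_algebra.
From mathcomp Require Import finmap.
From mathcomp Require boolp classical_sets.
From mathcomp.multinomials Require Import monalg.

Set Implicit Arguments.
Unset Strict Implicit.
Unset Printing Implicit Defensive.

Import GRing.Theory.
Local Open Scope ring_scope.

(* Labels are 0-based: [inl i] is the unprimed label i+1 and [inr i] is the
   primed label (i+1)'. *)
Definition vertex (k : nat) : finType := ('I_k + 'I_k)%type.

Definition diagram (k : nat) :=
  {P : {set {set vertex k}} | partition P [set: vertex k]}.
HB.instance Definition _ k := Finite.on (diagram k).

Definition pdiag := {k : nat & diagram k}.
(* Classical instances rather than those of sigma types: the latter compute, and
   failing unifications in [{malg K[pdiag]}] then unfold them for minutes. *)
HB.instance Definition _ := boolp.gen_eqMixin pdiag.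
HB.instance Definition _ := boolp.gen_choiceMixin pdiag.

Definition pd_order (p : pdiag) : nat := tag p.

Lemma empty_subproof : partition set0 [set: vertex 0].
Proof.
suff -> : [set: vertex 0] = set0 by rewrite partition_set0.
by apply/setP => -[] [].
Qed.

Definition pempty : pdiag :=
  Tagged diagram (exist _ set0 empty_subproof : diagram 0).

Definition vertex_l k m (x : vertex k) : vertex (k + m) :=
  match x with inl i => inl (lshift m i) | inr i => inr (lshift m i) end.

Definition vertex_r k m (x : vertex m) : vertex (k + m) :=
  match x with inl i => inl (rshift k i) | inr i => inr (rshift k i) end.

Arguments vertex_l {k} m x.
Arguments vertex_r k {m} x.

Definition tensor_blocks k m (P : {set {set vertex k}})
    (Q : {set {set vertex m}}) : {set {set vertex (k + m)}} :=
  [set vertex_l m @: (B : {set vertex k}) | B in P] :|: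
  [set vertex_r k @: (B : {set vertex m}) | B in Q].

Lemma vertex_l_inj k m : injective (@vertex_l k m).
Proof. by move=> [] i [] j //= [] /val_inj ->. Qed.

Lemma vertex_r_inj k m : injective (@vertex_r k m).
Proof. by move=> [] i [] j //= [] /addnI /val_inj ->. Qed.

Lemma vertex_lr_disjoint k m :
  [disjoint (@vertex_l k m) @: [set: vertex k] &
            (@vertex_r k m) @: [set: vertex m]].
Proof.
rewrite disjoints_subset; apply/subsetP => _ /imsetP[x _ ->].
rewrite inE; apply/imsetP => -[y _].
case: x y => [] i [] j //= [] /eqP; rewrite eqn_leq => /andP[_ le_i];
  by have := leq_ltn_trans le_i (ltn_ord i); rewrite ltnNge leq_addr.
Qed.

Lemma vertex_lr_cover k m :
  (@vertex_l k m) @: [set: vertex k] :|: (@vertex_r k m) @: [set: vertex m]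
    = [set: vertex (k + m)].
Proof.
apply/setP => x; rewrite !inE; apply/orP.
by case: x => i; case: (split_ordP i) => j ->; [left|right|left|right];
  apply/imsetP; (exists (inl j) + exists (inr j)).
Qed.

Lemma tensor_subproof k m (p : diagram k) (q : diagram m) :
  partition (tensor_blocks (val p) (val q)) [set: vertex (k + m)].
Proof.
have := valP p; rewrite /= -(imset_partition _ _ (@vertex_l_inj k m)).
have := valP q; rewrite /= -(imset_partition _ _ (@vertex_r_inj k m)).
move=> /and3P[/eqP cQ tQ nQ] /and3P[/eqP cP tP nP].
apply/and3P; split.
- rewrite /tensor_blocks -vertex_lr_cover -cP -cQ; apply/eqP.
  by rewrite /cover bigcup_setU.
- by apply: trivIsetU => //; rewrite cP cQ vertex_lr_disjoint.
- by rewrite inE negb_or nP.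
Qed.

Definition tensor_diagram k m (p : diagram k) (q : diagram m) : diagram (k + m) :=
  exist _ (tensor_blocks (val p) (val q)) (tensor_subproof p q).

Definition pd_tensor (p q : pdiag) : pdiag :=
  Tagged diagram (tensor_diagram (tagged p) (tagged q)).

Definition merge_blocks (T : finType) (P : {set {set T}}) (x y : T) :
    {set {set T}} :=
  (pblock P x :|: pblock P y) |: (P :\ pblock P x :\ pblock P y).

Lemma merge_subproof (T : finType) (P : {set {set T}}) (x y : T) :
  partition P [set: T] -> partition (merge_blocks P x y) [set: T].
Proof.
move=> pP; have cP z : z \in cover P by rewrite (cover_partition pP) inE.
have bP z : pblock P z \in P by exact: pblock_mem.
have zP z : z \in pblock P z by rewrite mem_pblock.
pose B := pblock P x; pose C := pblock P y.
have pPB : partition (P :\ B) ([set: T] :\: B).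
  exact: partitionD1 pP (bP x).
have pPBC : partition (P :\ B :\ C) ([set: T] :\: (B :|: C)).
  have [BC|neBC] := eqVneq C B.
    by rewrite BC setDDl !setUid.
  rewrite -setDDl; apply: partitionD1 => //.
  by rewrite !inE neBC bP.
rewrite /merge_blocks -/B -/C -[X in partition _ X](setID _ (B :|: C)).
rewrite setTI; apply: partitionU1 => //.
- by apply/set0Pn; exists x; rewrite inE zP.
- by rewrite disjoint_sym disjoints_subset setDE subsetIr.
Qed.

Definition bullet_diagram k m (p : diagram k.+1) (q : diagram m.+1) :
    diagram (k.+1 + m.+1) :=
  exist _ (merge_blocks (val (tensor_diagram p q))
             (inr (lshift m.+1 ord_max)) (inr (rshift k.+1 ord0)))
          (merge_subproof _ _ (valP (tensor_diagram p q))).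

Definition pd_bullet (p q : pdiag) : pdiag :=
  match p, q with
  | existT 0 _, _ => q
  | existT _.+1 _, existT 0 _ => p
  | existT k.+1 p', existT m.+1 q' => Tagged diagram (bullet_diagram p' q')
  end.

Definition irreducible_for (op : pdiag -> pdiag -> pdiag) (p : pdiag) : Prop :=
  ~ exists a b : pdiag, [/\ a <> pempty, b <> pempty & p = op a b].

Definition tensor_irreducible := irreducible_for pd_tensor.
Definition bullet_irreducible := irreducible_for pd_bullet.

Definition tensor_factorization (p : pdiag) (s : seq pdiag) : Prop :=
  {in s, forall a, a <> pempty /\ tensor_irreducible a} /\
  p = foldr pd_tensor pempty s.

(* [xget d A] is an element of [A] when there is one, and [d] otherwise; every
   diagram has exactly one factorization ([[::]] for the empty diagram). *)
Definition tensor_factors (p : pdiag) : seq pdiag :=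
  classical_sets.xget [::] (tensor_factorization p).

Definition pd_len (p : pdiag) : nat := size (tensor_factors p).

(* [(p1, [:: (o1, p2); ...; (o_(n-1), pn)])] encodes the expression
   p1 o1 p2 o2 ... o_(n-1) pn, where [true] stands for the tensor product and
   [false] for the bullet product. *)
Definition expression := (pdiag * seq (bool * pdiag))%type.

Fixpoint eval_expression (p : pdiag) (s : seq (bool * pdiag)) : pdiag :=
  if s is (o, p') :: s' then
    (if o then pd_tensor else pd_bullet) p (eval_expression p' s')
  else p.

Definition is_refinement (p : pdiag) (e : expression) : Prop :=
  {in e.1 :: unzip2 e.2,
     forall a, [/\ a <> pempty, tensor_irreducible a & bullet_irreducible a]} /\
  p = eval_expression e.1 e.2.

(* Exactly one expression qualifies when [p] is non-empty; the value at the
   empty diagram is never used. *)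
Definition refinement (p : pdiag) : expression :=
  classical_sets.xget (pempty, [::]) (is_refinement p).

Definition refinement_factors (p : pdiag) : seq pdiag :=
  (refinement p).1 :: unzip2 (refinement p).2.

(* The set S(p), with positions numbered from 1. *)
Definition tensor_positions (p : pdiag) : seq nat :=
  let ops := unzip1 (refinement p).2 in
  [seq i <- iota 1 (size ops) | nth false ops i.-1].

Definition pd_sim (p s : pdiag) : bool :=
  if (p == pempty) || (s == pempty) then p == s
  else refinement_factors p == refinement_factors s.

Definition pd_le (p s : pdiag) : bool :=
  if (p == pempty) || (s == pempty) then p == s
  else pd_sim p s && all (mem (tensor_positions p)) (tensor_positions s).

Section ParSym.
Variable K : fieldType.

Definition ParSym := {malg K[pdiag]}.
Definition ParQSym := {malg K[pdiag]}.
HB.instance Definition _ := GRing.Lmodule.on ParSym.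
HB.instance Definition _ := GRing.Lmodule.on ParQSym.

Definition pd_H (p : pdiag) : ParSym := << p >>.
Definition pd_M (p : pdiag) : ParQSym := << p >>.

Definition pd_pairing (f : ParQSym) (h : ParSym) : K :=
  \sum_(p <- msupp f) mcoeff p f * mcoeff p h.

(* Related diagrams have the same order, so the sums over all s >= p and all
   s <= p only involve the finitely many diagrams of the order of p. *)
Definition pd_eta (q : K) (p : pdiag) : ParQSym :=
  let r := q + 1 in
  \sum_(s : diagram (pd_order p) | pd_le p (Tagged diagram s))
     r ^+ pd_len (Tagged diagram s) *: pd_M (Tagged diagram s).

Definition pd_kappa (q : K) (p : pdiag) : ParSym :=
  let r := q + 1 in
  \sum_(s : diagram (pd_order p) | pd_le (Tagged diagram s) p)
     ((-1) ^ ((pd_len (Tagged diagram s))%:Z - (pd_len p)%:Z)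
        * r ^- pd_len (Tagged diagram s)) *: pd_H (Tagged diagram s).

Definition is_basis (I : eqType) (V : lmodType K) (b : I -> V) : Prop :=
  (forall (s : seq I) (c : I -> K), uniq s ->
     \sum_(i <- s) c i *: b i = 0 -> {in s, forall i, c i = 0}) /\
  (forall v : V, exists (s : seq I) (c : I -> K), v = \sum_(i <- s) c i *: b i).

Lemma pairingE (D : {fset pdiag}) (f : ParQSym) (h : ParSym) :
  (msupp f `<=` D)%fset ->
  pd_pairing f h = \sum_(p <- D) mcoeff p f * mcoeff p h.
Proof.
move=> fD; rewrite /pd_pairing (big_fset_incl _ fD) //= => p _ pf.
by rewrite mcoeff_outdom ?mul0r.
Qed.

Lemma pairing_linearl (c : K) (f g : ParQSym) (h : ParSym) :
  pd_pairing (c *: f + g) h = c * pd_pairing f h + pd_pairing g h.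
Proof.
pose D := (msupp f `|` msupp g `|` msupp (c *: f + g))%fset.
rewrite !(@pairingE D) ?fsubsetUr //; last 2 first.
- by rewrite /D -fsetUA fsubsetU // fsubsetU ?fsubset_refl ?orbT.
- by rewrite /D -fsetUA fsubsetUl.
rewrite mulr_sumr -big_split; apply: eq_bigr => p _ /=.
by rewrite mcoeffD mcoeffZ mulrDl mulrA.
Qed.

Lemma pairing_linearr (c : K) (f : ParQSym) (h k : ParSym) :
  pd_pairing f (c *: h + k) = c * pd_pairing f h + pd_pairing f k.
Proof.
rewrite /pd_pairing mulr_sumr -big_split; apply: eq_bigr => p _ /=.
by rewrite mcoeffD mcoeffZ mulrDr mulrCA.
Qed.

Lemma pairingMH (p s : pdiag) : pd_pairing (pd_M p) (pd_H s) = (p == s)%:R.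
Proof.
by rewrite (@pairingE [fset p]%fset) ?msuppU_le // big_seq_fset1 /pd_M /pd_H
  !mcoeffU eqxx mul1r eq_sym.
Qed.

End ParSym.

Arguments pd_H {K} p.
Arguments pd_M {K} p.
Arguments pd_pairing {K} f h.
Arguments pd_eta {K} q p.
Arguments pd_kappa {K} q p.
Arguments is_basis {K I V} b.

(* Main.v *)
(* Number the columns from 0, relabel i as 2i and i' as 2i+1, and view a diagram
   as an equivalence relation on {0, ..., 2n-1}. Whether a diagram factors after
   its first k columns, and by which of the two products, is then read off the
   related pairs that straddle 2k, and the two factors are the restrictions to
   the two sides. Comparing first factors gives the mixed associativity and the
   uniqueness of the refinement, and l(p) = 1 + |S(p)|. So an interval [rho, pi]
   is a Boolean lattice, and the pairing of eta_rho and kappa_pi is its sum of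
   signs, which vanishes for rho <> pi by exchanging the two products at some i
   in S(rho) \ S(pi). In each order this is an identity A B^T = 1 of square
   matrices, hence B^T A = 1, which expresses M and H through eta and kappa. *)
Require Import Defs.
From HB Require Import structures.
From mathcomp Require Import all_boot all_order all_algebra.
From mathcomp.multinomials Require Import monalg.
From Corelib Require Setoid Morphisms.
From mathcomp Require Import finmap zify.
From mathcomp Require boolp classical_sets.

Set Implicit Arguments.
Unset Strict Implicit.
Unset Printing Implicit Defensive.

Import GRing.Theory.

(** * Diagrams as equivalence relations *)

Section SameBlock.
Variable T : finType.
Implicit Types P : {set {set T}}.

(** Stated with an arbitrary common block rather than [pblock], so that symmetry is immediate and
    images of blocks under the two embeddings can serve as witnesses. *)
Definition same_block P (u v : T) : bool :=
  [exists B in P, (u \in B) && (v \in B)].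

Lemma same_blockP P u v :
  reflect (exists B, [/\ B \in P, u \in B & v \in B]) (same_block P u v).
Proof.
apply: (iffP existsP) => -[B].
  by case/and3P=> BP uB vB; exists B.
by case=> BP uB vB; exists B; rewrite BP uB vB.
Qed.

Lemma same_blockE P u v : partition P [set: T] ->
  same_block P u v = (v \in pblock P u).
Proof.
move=> pP; have tP := partition_trivIset pP.
have cP z : z \in cover P by rewrite (cover_partition pP) inE.
apply/same_blockP/idP => [[B [BP uB vB]]|vu].
  by rewrite (def_pblock tP BP uB).
by exists (pblock P u); rewrite pblock_mem ?mem_pblock.
Qed.

Lemma same_block_sym P : symmetric (same_block P).
Proof. by move=> u v; apply: eq_existsb => B; rewrite (andbC (u \in B)). Qed.

Lemma same_block_refl P u : partition P [set: T] -> same_block P u u.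
Proof.
by move=> pP; rewrite same_blockE // mem_pblock (cover_partition pP) inE.
Qed.

Lemma same_block_trans P : partition P [set: T] -> transitive (same_block P).
Proof.
move=> pP v u w /same_blockP[B [BP uB vB]] /same_blockP[C [CP vC wC]].
have tP := partition_trivIset pP.
apply/same_blockP; exists B; split=> //.
by rewrite -(def_pblock tP BP vB) (def_pblock tP CP vC).
Qed.

Lemma same_block_inj P Q : partition P [set: T] -> partition Q [set: T] ->
  same_block P =2 same_block Q -> P = Q.
Proof.
have half P' Q' : partition P' [set: T] -> partition Q' [set: T] ->
    same_block P' =2 same_block Q' -> P' \subset Q'.
  move=> pP pQ PQ; apply/subsetP=> B BP.
  have /set0Pn[u uB] := partition_neq0 pP BP.
  have eB : B = pblock Q' u.
    rewrite -(def_pblock (partition_trivIset pP) BP uB); apply/setP=> v.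
    by rewrite -!same_blockE.
  by rewrite eB pblock_mem // (cover_partition pQ) inE.
by move=> pP pQ PQ; apply/eqP; rewrite eqEsubset !half // => u v; rewrite PQ.
Qed.

(** Two points share a block after the merge either in the new block, or in an old block that was
    kept or absorbed by it. Nothing assumes that [x] and [y] start in different blocks. *)
Lemma same_block_merge P x y u v : partition P [set: T] ->
  same_block (merge_blocks P x y) u v =
  same_block P u v || (same_block P u x || same_block P u y)
                   && (same_block P v x || same_block P v y).
Proof.
move=> pP; have tP := partition_trivIset pP.
rewrite !(same_block_sym P _ x) !(same_block_sym P _ y).
apply/idP/idP.
  move=> /same_blockP[B [+ uB vB]]; rewrite !inE => /orP[/eqP BE|].
    by move: uB vB; rewrite BE !inE !same_blockE // => -> ->; rewrite orbT.
  case/and3P=> _ _ BP; apply/orP; left; apply/same_blockP.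
  by exists B.
case: (boolP (_ && _)) => [m _|nm].
  move: m; rewrite !(same_blockE x _ pP) !(same_blockE y _ pP).
  move=> /andP[uxy vxy].
  apply/same_blockP; exists (pblock P x :|: pblock P y).
  by rewrite !inE eqxx uxy vxy.
rewrite orbF => uv; have /same_blockP[B [BP uB vB]] := uv.
apply/same_blockP; exists B; split=> //; rewrite !inE BP andbT.
apply/orP; right; rewrite -negb_or; apply: contra nm.
rewrite !same_blockE //.
by case/orP=> /eqP <-; rewrite uB vB ?orbT.
Qed.

End SameBlock.

(** Interleaving the two rows makes the first [k] columns the initial segment below [k.*2], whatever
    the order of the diagram, so questions of position become linear arithmetic. *)
Definition vcode k (u : vertex k) : nat :=
  match u with inl i => i.*2 | inr i => i.*2.+1 end.

Lemma vcode_inj k : injective (@vcode k).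
Proof. by move=> [] i [] j /= e; try lia; congr (_ _); apply: ord_inj; lia. Qed.

Lemma vcode_lt k (u : vertex k) : vcode u < k.*2.
Proof. by case: u => i /=; have := ltn_ord i; lia. Qed.

Lemma vcode_onto k x : x < k.*2 -> exists u : vertex k, vcode u = x.
Proof.
move=> xk; have xk2 : x./2 < k by lia.
case: (boolP (odd x)) => ox.
  by exists (inr (Ordinal xk2)); rewrite /=; lia.
by exists (inl (Ordinal xk2)); rewrite /=; lia.
Qed.

Lemma vcode_l k m (u : vertex k) : vcode (vertex_l m u) = vcode u.
Proof. by case: u. Qed.

Lemma vcode_r k m (u : vertex m) : vcode (vertex_r k u) = k.*2 + vcode u.
Proof. by case: u => i /=; lia. Qed.

(** A relation on natural numbers rather than on vertices: diagrams whose orders are equal only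
    propositionally can then be compared without transport. *)
Definition linked (p : pdiag) (x y : nat) : Prop :=
  exists u v : vertex (tag p),
    [/\ vcode u = x, vcode v = y & same_block (val (tagged p)) u v].

Lemma linked_vcode (p : pdiag) (u v : vertex (tag p)) :
  linked p (vcode u) (vcode v) <-> same_block (val (tagged p)) u v.
Proof.
split=> [[u' [v' [/vcode_inj -> /vcode_inj -> //]]]|uv].
by exists u, v.
Qed.

Lemma linked_lt p x y : linked p x y ->
  x < (pd_order p).*2 /\ y < (pd_order p).*2.
Proof. by case=> u [v [<- <- _]]; split; apply: vcode_lt. Qed.

Lemma linked_refl p x : x < (pd_order p).*2 -> linked p x x.
Proof.
case/vcode_onto=> u <-; apply/linked_vcode/same_block_refl.
exact: valP (tagged p).
Qed.

Lemma linked_sym p x y : linked p x y -> linked p y x.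
Proof. by case=> u [v [<- <- uv]]; exists v, u; rewrite same_block_sym. Qed.

Lemma linked_trans p x y z : linked p x y -> linked p y z -> linked p x z.
Proof.
case=> u [v [<- <- uv]] [v' [w [/vcode_inj -> <- vw]]]; exists u, w; split=> //.
exact: same_block_trans (valP (tagged p)) _ _ _ uv vw.
Qed.

Lemma linked_inj p q : pd_order p = pd_order q ->
  (forall x y, linked p x y <-> linked q x y) -> p = q.
Proof.
case: p q => n P [n' Q] /= nn'; rewrite /pd_order /= in nn'; subst n' => PQ.
congr (existT _ _ _); apply: val_inj.
apply: same_block_inj (valP P) (valP Q) _ => u v.
have /= eP := @linked_vcode (existT _ n P) u v.
have /= eQ := @linked_vcode (existT _ n Q) u v.
by apply/idP/idP=> /[dup] h; [move/eP/PQ/eQ | move/eQ/PQ/eP].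
Qed.

Lemma linked_exists n (E : nat -> nat -> Prop) :
    (forall x, x < n.*2 -> E x x) -> (forall x y, E x y -> E y x) ->
    (forall x y z, E x y -> E y z -> E x z) ->
  exists p, pd_order p = n /\
    forall x y, linked p x y <-> [/\ x < n.*2, y < n.*2 & E x y].
Proof.
move=> Er Es Et.
(* [equivalence_partition] takes a boolean relation, hence the classical decision of [E]. *)
pose e (u v : vertex n) := boolp.asbool (E (vcode u) (vcode v)).
have eqe : {in [set: vertex n] & &, equivalence_rel e}.
  move=> u v w _ _ _; split; first exact/boolp.asboolP/Er/vcode_lt.
  move=> /boolp.asboolP uv; apply/boolp.asboolP/boolp.asboolP; last exact: Et.
  by apply: Et; apply: Es.
have pP := equivalence_partitionP eqe.
pose P : diagram n :=
  exist (fun Q => is_true (partition Q [set: vertex n])) _ pP.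
exists (Tagged diagram P); split=> // x y.
split.
  move=> [u [v [<- <-]]] /=; rewrite same_blockE // => uv.
  rewrite !vcode_lt; split=> //.
  by move: uv; rewrite pblock_equivalence_partition ?inE // => /boolp.asboolP.
case=> /vcode_onto[u <-] /vcode_onto[v <-] uv.
exists u, v; split=> //=; rewrite same_blockE //.
by rewrite pblock_equivalence_partition ?inE //; apply/boolp.asboolP.
Qed.

Lemma order_tensor p q : pd_order (pd_tensor p q) = pd_order p + pd_order q.
Proof. by []. Qed.

Lemma linked_tensor p q x y :
  linked (pd_tensor p q) x y <->
  linked p x y \/
  [/\ (pd_order p).*2 <= x, (pd_order p).*2 <= y &
      linked q (x - (pd_order p).*2) (y - (pd_order p).*2)].
Proof.
split.
  case=> u [v [<- <- /same_blockP[B [/= + uB vB]]]].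
  rewrite !inE => /orP[] /imsetP[C CP BE]; move: uB vB; rewrite BE.
    move=> /imsetP[u' u'C ->] /imsetP[v' v'C ->]; left.
    rewrite !vcode_l; apply/linked_vcode/same_blockP; by exists C.
  move=> /imsetP[u' u'C ->] /imsetP[v' v'C ->]; right.
  rewrite !vcode_r !addKn; split; rewrite ?leq_addr //.
  by apply/linked_vcode/same_blockP; exists C.
case=> [[u [v [<- <- /same_blockP[B [BP uB vB]]]]]|].
  exists (vertex_l (pd_order q) u), (vertex_l (pd_order q) v).
  rewrite !vcode_l; split=> //; apply/same_blockP.
  exists (vertex_l (pd_order q) @: B); rewrite !imset_f //=; split=> //.
  by rewrite inE imset_f.
case=> kx ky [u [v [ux vy /same_blockP[B [BP uB vB]]]]].
exists (vertex_r (pd_order p) u), (vertex_r (pd_order p) v).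
rewrite !vcode_r ux vy !subnKC //; split=> //; apply/same_blockP.
exists (vertex_r (pd_order p) @: B); rewrite !imset_f //=; split=> //.
by rewrite inE [X in _ || X]imset_f ?orbT.
Qed.

Lemma order_bullet p q : pd_order (pd_bullet p q) = pd_order p + pd_order q.
Proof. by case: p q => [[|k] P] [[|m] Q] //=; rewrite /pd_order /= addn0. Qed.

(** With [k] twice the order of [p], [k.-1] and [k.+1] are the codes of the last primed label of [p]
    and of the first primed label of [q], the two labels whose blocks are merged. *)
Lemma linked_bullet p q x y : 0 < pd_order p -> 0 < pd_order q ->
  let k := (pd_order p).*2 in
  let L := linked (pd_tensor p q) in
  linked (pd_bullet p q) x y <->
  L x y \/ (L x k.-1 \/ L x k.+1) /\ (L y k.-1 \/ L y k.+1).
Proof.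
case: p q => [[|k] P] [[|m] Q] // _ _.
set p := existT _ _ P; set q := existT _ _ Q; set t := pd_tensor p q.
have ck : (k.+1).*2.-1 = @vcode (k.+1 + m.+1) (inr (lshift m.+1 ord_max)).
  by rewrite /=; lia.
have cm : (k.+1).*2.+1 = @vcode (k.+1 + m.+1) (inr (rshift k.+1 ord0)).
  by rewrite /=; lia.
cbv zeta; change (pd_order p) with k.+1; rewrite ck cm -/t.
set a : vertex (tag t) := inr _; set b : vertex (tag t) := inr _.
have Lt u v := @linked_vcode t u v.
have pt := valP (tagged t).
have Lm (u v : vertex (tag t)) :
    linked (Tagged diagram (bullet_diagram P Q)) (vcode u) (vcode v) <->
    same_block (merge_blocks (val (tagged t)) a b) u v.
  exact: (@linked_vcode (Tagged diagram (bullet_diagram P Q)) u v).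
split.
  move=> l; have [] := linked_lt l.
  move=> /vcode_onto[u ux] /vcode_onto[v vy]; move: l; rewrite -ux -vy.
  move=> /Lm; rewrite (same_block_merge _ _ _ _ pt).
  case/orP=> [uv|/andP[ua va]]; first by left; apply/Lt.
  by right; split; [case/orP: ua => h | case/orP: va => h];
    [left|right|left|right]; apply/Lt.
move=> l.
have [] : x < (pd_order t).*2 /\ y < (pd_order t).*2.
  case: l => [/linked_lt //|[lx ly]].
  by case: lx ly => /linked_lt[? _] [] /linked_lt[? _].
move=> /vcode_onto[u ux] /vcode_onto[v vy]; move: l; rewrite -ux -vy => l.
apply/Lm; rewrite (same_block_merge _ _ _ _ pt).
case: l => [/Lt -> //|[lx ly]]; apply/orP; right; apply/andP.
by split; [case: lx => /Lt -> | case: ly => /Lt ->]; rewrite ?orbT.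
Qed.

(** Lets [rewrite] use equivalences inside triple conjunctions. *)
#[local] Instance and3_iff :
  Morphisms.Proper
    (Morphisms.respectful iff (Morphisms.respectful iff
      (Morphisms.respectful iff iff))) and3.
Proof.
by move=> A A' [? ?] B B' [? ?] C C' [? ?]; split=> -[]; split; auto.
Qed.

Definition pd_op (o : bool) : pdiag -> pdiag -> pdiag :=
  if o then pd_tensor else pd_bullet.

Lemma order_op o p q : pd_order (pd_op o p q) = pd_order p + pd_order q.
Proof. by case: o; [apply: order_tensor | apply: order_bullet]. Qed.

Lemma pd_order_gt0 p : (0 < pd_order p) <-> p <> pempty.
Proof.
split=> [p0 pe|pe]; first by rewrite pe in p0.
rewrite lt0n; apply/eqP => p0; apply: pe; apply: linked_inj => // x y.
by split=> /linked_lt[]; rewrite ?p0.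
Qed.

Lemma tensord0 p : pd_tensor p pempty = p.
Proof.
apply: linked_inj => [|x y]; first by rewrite order_tensor addn0.
rewrite linked_tensor; split=> [[//|[_ _ /linked_lt[]//]]|]; by left.
Qed.

Lemma linked_tensor_side p q x y : linked (pd_tensor p q) x y ->
  (x < (pd_order p).*2) = (y < (pd_order p).*2).
Proof. by case/linked_tensor=> [/linked_lt[-> ->] //|[? ? _]]; lia. Qed.

(** * Restriction to consecutive columns, and cuts *)

Lemma subdiag_exists p a n : exists s, pd_order s = n /\
  forall x y, linked s x y <->
    [/\ x < n.*2, y < n.*2 & x = y \/ linked p (a.*2 + x) (a.*2 + y)].
Proof.
apply: linked_exists => [x _|x y|x y z]; first by left.
  by case=> [->|/linked_sym]; [left|right].
case=> [-> //|xy] [<-|yz]; right=> //; exact: linked_trans xy yz.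
Qed.

(* Meaningful only if a + n is at most the order of [p]; beyond it the disjunct
   [x = y] above fills in singleton blocks. *)
Definition subdiag p a n : pdiag := sval (boolp.cid (subdiag_exists p a n)).

Lemma order_subdiag p a n : pd_order (subdiag p a n) = n.
Proof. by rewrite /subdiag; case: boolp.cid => s []. Qed.

Lemma linked_subdiag p a n x y : a + n <= pd_order p ->
  linked (subdiag p a n) x y <->
  [/\ x < n.*2, y < n.*2 & linked p (a.*2 + x) (a.*2 + y)].
Proof.
move=> an; rewrite /subdiag; case: boolp.cid => s [_ /= ->].
split=> [[xn yn [<-|]]|[xn yn]]; split=> //; last by right.
by apply: linked_refl; lia.
Qed.

Lemma subdiag_subdiag p a n b m : a + n <= pd_order p -> b + m <= n ->
  subdiag (subdiag p a n) b m = subdiag p (a + b) m.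
Proof.
move=> an bm; apply: linked_inj => [|x y]; first by rewrite !order_subdiag.
rewrite linked_subdiag ?order_subdiag // !linked_subdiag //; try lia.
have e z : (a + b).*2 + z = a.*2 + (b.*2 + z) by lia.
rewrite !e.
by split=> [[? ? []]|[? ? ?]] //; split=> //; split=> //; lia.
Qed.

(* [p] is a product of diagrams of orders [k] and [pd_order p - k], a tensor
   product if [o] and a bullet product otherwise: see [cut_op], [op_subdiag]. *)
Definition cut (o : bool) (p : pdiag) (k : nat) : Prop :=
  (~~ o -> linked p k.*2.-1 k.*2.+1) /\
  forall x y, x < k.*2 <= y -> linked p x y -> ~~ o /\ linked p x k.*2.-1.

(** No pair straddles the boundary in the tensor product. In the bullet product such a pair comes
    from the merge, so its left member is linked to the last primed label of [p]. *)
Lemma cut_op o p q : 0 < pd_order p -> 0 < pd_order q ->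
  cut o (pd_op o p q) (pd_order p).
Proof.
move=> p0 q0.
have side x y : x < (pd_order p).*2 <= y -> ~ linked (pd_tensor p q) x y.
  by case/andP=> xk ky /linked_tensor_side; lia.
case: o; first by split=> // x y /side.
split=> [_|x y xy]; rewrite !linked_bullet //.
  by right; split; [left|right]; apply: linked_refl; rewrite order_tensor; lia.
case=> [/side -/(_ xy)//|[[|]]]; first by split=> //; left.
by move/side; case; lia.
Qed.

Lemma linked_tensor_subdiag p k x y : k <= pd_order p ->
  linked (pd_tensor (subdiag p 0 k) (subdiag p k (pd_order p - k))) x y <->
  linked p x y /\ (x < k.*2) = (y < k.*2).
Proof.
move=> kp; rewrite linked_tensor !linked_subdiag ?order_subdiag; try lia.
rewrite !add0n; split=> [[[-> -> ?]//|[kx ky [_ _]]]|[l xy]].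
  by rewrite !subnKC // => l; split=> //; lia.
have [xp yp] := linked_lt l.
case: (ltnP x k.*2) => xk; first by left; split=> //; lia.
by right; split; rewrite ?subnKC //; try split=> //; lia.
Qed.

(** The tensor product of the two restrictions loses exactly the straddling pairs. At a tensor cut
    there are none; at a bullet cut they all lie in the class of [k.*2.-1] and [k.*2.+1], which the
    merge restores. *)
Lemma op_subdiag o p k : 0 < k < pd_order p -> cut o p k ->
  p = pd_op o (subdiag p 0 k) (subdiag p k (pd_order p - k)).
Proof.
move=> kp [c1 c2]; apply: linked_inj => [|x y].
  by rewrite order_op !order_subdiag; lia.
have kp' : k <= pd_order p by lia.
have L := linked_tensor_subdiag _ _ kp'.
case: o c1 c2 => [_|/(_ isT) c1] c2.
  rewrite /pd_op L; split=> [l|[]//]; split=> //.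
  apply/idP/idP=> h; apply/negPn/negP=> h'.
    by case: (c2 x y _ l) => //; lia.
  by case: (c2 y x _ (linked_sym l)) => //; lia.
rewrite /pd_op linked_bullet ?order_subdiag; try lia.
rewrite !L; split=> [l|]; last first.
  have lk z : linked p z k.*2.-1 \/ linked p z k.*2.+1 -> linked p z k.*2.-1.
    by case=> // l; apply: linked_trans l (linked_sym c1).
  case=> [[]//|[lx ly]]; apply: (@linked_trans _ _ k.*2.-1).
    by apply: lk; case: lx => -[]; [left|right].
  by apply: linked_sym; apply: lk; case: ly => -[]; [left|right].
have main u v : u < k.*2 <= v -> linked p u v ->
    linked p u k.*2.-1 /\ linked p v k.*2.+1.
  move=> uv luv; have [_ lu] := c2 _ _ uv luv; split=> //.
  exact: linked_trans (linked_trans (linked_sym luv) lu) c1.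
case: (ltnP x k.*2) (ltnP y k.*2) => xk [] yk; [by left| | |by left]; right.
  by have [|l1 l2] := main x y _ l; [lia|split; [left|right]; split=> //; lia].
by have [|l1 l2] := main y x _ (linked_sym l);
  [lia|split; [right|left]; split=> //; lia].
Qed.

(** A merge creates no new pair on one side of the boundary: two labels on the same side that meet
    the merged block were already linked to the same one of its two halves. *)
Lemma linked_op_tensor o p q x y : 0 < pd_order p -> 0 < pd_order q ->
  linked (pd_tensor p q) x y <->
  linked (pd_op o p q) x y /\ (x < (pd_order p).*2) = (y < (pd_order p).*2).
Proof.
move=> p0 q0; case: o => /=.
  by split=> [l|[] //]; split=> //; apply: linked_tensor_side l.
rewrite linked_bullet //.
split=> [l|[]]; first by split; [left|apply: linked_tensor_side l].
case=> // -[lx ly] xy.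
have [z [xz yz]] : exists z, linked (pd_tensor p q) x z /\
    linked (pd_tensor p q) y z.
  case: lx ly => lx [] ly; try by eexists; split; eassumption.
    by have := linked_tensor_side lx; have := linked_tensor_side ly; lia.
  by have := linked_tensor_side lx; have := linked_tensor_side ly; lia.
exact: linked_trans xz (linked_sym yz).
Qed.

Lemma subdiag_op_l o p q : 0 < pd_order p -> 0 < pd_order q ->
  subdiag (pd_op o p q) 0 (pd_order p) = p.
Proof.
move=> p0 q0; apply: linked_inj => [|x y]; first by rewrite order_subdiag.
rewrite linked_subdiag ?order_op ?leq_addr // !add0n.
have := linked_op_tensor o x y p0 q0; rewrite linked_tensor => T.
split=> [[xp yp l]|l].
  by case: (T.2 _) => [|//|[]]; [rewrite xp yp|lia].
have [xp yp] := linked_lt l.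
by split=> //; apply: (T.1 _).1; left.
Qed.

Lemma subdiag_op_r o p q : 0 < pd_order p -> 0 < pd_order q ->
  subdiag (pd_op o p q) (pd_order p) (pd_order q) = q.
Proof.
move=> p0 q0; apply: linked_inj => [|x y]; first by rewrite order_subdiag.
rewrite linked_subdiag ?order_op //.
have := linked_op_tensor o ((pd_order p).*2 + x) ((pd_order p).*2 + y) p0 q0.
rewrite linked_tensor !addKn !leq_addr => T.
split=> [[xp yp l]|l].
  by case: (T.2 _) => [|/linked_lt[]|[]//]; [split=> //|]; lia.
have [xp yp] := linked_lt l.
by split=> //; apply: (T.1 _).1; right.
Qed.

(** * Unique factorization *)

Lemma cut_subdiag o p a n k : a + n <= pd_order p -> a < k < a + n ->
  cut o p k -> cut o (subdiag p a n) (k - a).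
Proof.
move=> an ak [c1 c2].
have e1 : a.*2 + (k - a).*2.-1 = k.*2.-1 by lia.
have e2 : a.*2 + (k - a).*2.+1 = k.*2.+1 by lia.
split=> [/c1 l|x y xy]; rewrite !linked_subdiag // e1 ?e2.
  by split=> //; lia.
case=> xn yn /c2[|-> l]; first by lia.
by split=> //; split=> //; lia.
Qed.

(** A bullet cut links [k.*2.-1] to [k.*2.+1], a straddling pair that a tensor cut forbids. *)
Lemma cut_inj o o' p k : 0 < k < pd_order p ->
  cut o p k -> cut o' p k -> o = o'.
Proof.
have half : 0 < k < pd_order p -> ~ (cut true p k /\ cut false p k).
  move=> kp [[_ c2] [/(_ isT) c1 _]].
  by case: (c2 _ _ _ c1) => //; lia.
by case: o o' => -[] // kp c c'; case: (half kp).
Qed.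

(** A pair across [k] either stays before [k'], where the restriction sees it, or also crosses [k'].
    In the latter case its left member is linked to [k'.*2.-1], which gives a pair across [k] of the
    first kind. *)
Lemma cut_lift o o' p k k' : k < k' <= pd_order p ->
  cut o p k' -> cut o' (subdiag p 0 k') k -> cut o' p k.
Proof.
move=> kk' [_ d2] [c1 c2]; have k'p : 0 + k' <= pd_order p by lia.
split=> [/c1|x y xy l]; first by rewrite linked_subdiag // !add0n => -[].
have c2' v : v < k'.*2 -> x < k.*2 <= v -> linked p x v ->
    ~~ o' /\ linked p x k.*2.-1.
  move=> vk' xv lv; case: (c2 x v) => //; rewrite ?linked_subdiag ?add0n //.
    by split=> //; lia.
  by move=> oo [_ _ ?].
case: (ltnP y k'.*2) => yk'; first exact: c2' l.
have [|_ lx] := d2 x y _ l; first by lia.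
by apply: c2' lx; lia.
Qed.

Lemma order_op_gt0 o p q : 0 < pd_order p -> 0 < pd_order q ->
  0 < pd_order p < pd_order (pd_op o p q).
Proof. by rewrite order_op; lia. Qed.

Section Cancellation.
Variables (o o' : bool) (a b a' b' : pdiag).
Hypotheses (a0 : 0 < pd_order a) (b0 : 0 < pd_order b).
Hypotheses (a'0 : 0 < pd_order a') (b'0 : 0 < pd_order b').
Hypothesis E : pd_op o a b = pd_op o' a' b'.

Lemma op_cancel : pd_order a = pd_order a' -> [/\ o = o', a = a' & b = b'].
Proof.
move=> aa'; have := congr1 pd_order E; rewrite !order_op aa' => /addnI bb'.
split.
- apply: (cut_inj (order_op_gt0 o a0 b0)) (cut_op _ a0 b0) _.
  by rewrite E aa'; apply: cut_op.
- by rewrite -(subdiag_op_l o a0 b0) E aa' subdiag_op_l.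
- by rewrite -(subdiag_op_r o a0 b0) E aa' bb' subdiag_op_r.
Qed.

(** Both boundaries are cuts of the common product, so the longer left factor and the longer right
    factor are each cut at the other boundary. *)
Lemma op_shift : pd_order a < pd_order a' ->
  exists c, [/\ 0 < pd_order c, a' = pd_op o a c & b = pd_op o' c b'].
Proof.
move=> aa'; have := congr1 pd_order E; rewrite !order_op => eo.
set p := pd_op o a b; have Ep : p = pd_op o' a' b' by [].
have op : pd_order p = pd_order a + pd_order b by rewrite order_op.
have ca : cut o p (pd_order a) by apply: cut_op.
have ca' : cut o' p (pd_order a') by rewrite Ep; apply: cut_op.
have eA : subdiag p 0 (pd_order a) = a by apply: subdiag_op_l.
have eA' : subdiag p 0 (pd_order a') = a' by rewrite Ep; apply: subdiag_op_l.
have eB : subdiag p (pd_order a) (pd_order b) = b by apply: subdiag_op_r.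
have eB' : subdiag p (pd_order a') (pd_order b') = b'.
  by rewrite Ep; apply: subdiag_op_r.
have cA' : cut o a' (pd_order a).
  by rewrite -[pd_order a]subn0 -eA'; apply: cut_subdiag => //; lia.
have cB : cut o' b (pd_order a' - pd_order a).
  by rewrite -[X in cut _ X]eB; apply: cut_subdiag => //; lia.
(* The middle factor consists of the columns between the two boundaries. *)
exists (subdiag p (pd_order a) (pd_order a' - pd_order a)).
rewrite order_subdiag; split; first by lia.
  rewrite [LHS](op_subdiag _ cA'); last by lia.
  by congr pd_op; rewrite -[X in subdiag X]eA' subdiag_subdiag //; lia.
rewrite [LHS](op_subdiag _ cB); last by lia.
congr pd_op; rewrite -[X in subdiag X]eB subdiag_subdiag ?addn0 //; try lia.
by rewrite -[RHS]eB'; congr subdiag; lia.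
Qed.

End Cancellation.

(** Both boundaries are cuts of the left side, the first one by [cut_lift]; cutting at the first and
    then at the second gives the right side. For an empty [b] the two sides would join [a] and [c]
    by [o] and by [o'] respectively. *)
Lemma op_assoc o o' a b c :
    0 < pd_order a -> 0 < pd_order b -> 0 < pd_order c ->
  pd_op o (pd_op o' a b) c = pd_op o' a (pd_op o b c).
Proof.
move=> a0 b0 c0; set p := LHS.
have ab0 : 0 < pd_order (pd_op o' a b) by rewrite order_op; lia.
have op : pd_order p = pd_order a + pd_order b + pd_order c.
  by rewrite !order_op.
have eAB : subdiag p 0 (pd_order a + pd_order b) = pd_op o' a b.
  by rewrite -(order_op o'); apply: subdiag_op_l.
have cB : cut o p (pd_order a + pd_order b).
  by rewrite -(order_op o'); apply: cut_op.
have cA : cut o' p (pd_order a).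
  by apply: (@cut_lift o) cB _; [lia|rewrite eAB; apply: cut_op].
rewrite [LHS](op_subdiag _ cA); last by lia.
congr pd_op.
  by rewrite -[RHS](subdiag_op_l o' a0 b0) -eAB subdiag_subdiag //; lia.
set d := LHS.
have cd : cut o d (pd_order b).
  rewrite -[pd_order b](addKn (pd_order a)).
  by apply: cut_subdiag => //; lia.
have od : pd_order d = pd_order b + pd_order c by rewrite order_subdiag; lia.
rewrite [LHS](op_subdiag _ cd); last by lia.
congr pd_op; rewrite subdiag_subdiag ?addn0; try lia.
  by rewrite -[RHS](subdiag_op_r o' a0 b0) -eAB subdiag_subdiag //; lia.
rewrite -[RHS](subdiag_op_r o ab0 c0) -/p order_op.
by congr subdiag; lia.
Qed.

(** * Refinements, tensor factorizations and lengths *)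

Definition pd_atom (a : pdiag) : Prop :=
  [/\ a <> pempty, tensor_irreducible a & bullet_irreducible a].

Lemma atom_op a o b c : 0 < pd_order b -> 0 < pd_order c ->
  pd_atom a -> a <> pd_op o b c.
Proof.
move=> /pd_order_gt0 b0 /pd_order_gt0 c0 [_ ta ba] e.
by case: o e => e; [apply: ta | apply: ba]; exists b, c.
Qed.

Lemma atom_or_op p : p <> pempty -> pd_atom p \/
  exists o b c, [/\ 0 < pd_order b, 0 < pd_order c & p = pd_op o b c].
Proof.
move=> p0; case: (boolp.EM (pd_atom p)) => [|na]; first by left.
right; apply: boolp.contrapT => h; apply: na; split=> // -[b [c [b0 c0 e]]].
  by apply: h; exists true, b, c; split=> //; apply/pd_order_gt0.
by apply: h; exists false, b, c; split=> //; apply/pd_order_gt0.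
Qed.

Lemma eval_expression_cons p o q s :
  eval_expression p ((o, q) :: s) = pd_op o p (eval_expression q s).
Proof. by case: o. Qed.

Lemma order_eval p s :
  pd_order (eval_expression p s) =
  pd_order p + \sum_(q <- unzip2 s) pd_order q.
Proof.
elim: s p => [|[o q] s IH] p; first by rewrite big_nil addn0.
by rewrite eval_expression_cons order_op IH big_cons.
Qed.

Lemma order_eval_gt0 p s : 0 < pd_order p -> 0 < pd_order (eval_expression p s).
Proof. by rewrite order_eval; lia. Qed.

Definition all_atoms (p : pdiag) (s : seq (bool * pdiag)) : Prop :=
  {in p :: unzip2 s, forall a, pd_atom a}.

Lemma all_atoms_cons p o q s :
  all_atoms p ((o, q) :: s) <-> pd_atom p /\ all_atoms q s.
Proof.
split=> [h|[hp hs] a]; last by rewrite inE => /orP[/eqP -> //|/hs].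
by split=> [|a ai]; apply: h; rewrite inE ?eqxx // ai orbT.
Qed.

Lemma all_atoms_head p s : all_atoms p s -> pd_atom p.
Proof. by apply; rewrite inE eqxx. Qed.

Lemma atom_order a : pd_atom a -> 0 < pd_order a.
Proof. by case=> /pd_order_gt0. Qed.

(** If the first factors had different orders, [op_shift] would split the longer one, against its
    irreducibility; otherwise [op_cancel] removes them. *)
Lemma eval_inj p s p' s' : all_atoms p s -> all_atoms p' s' ->
  eval_expression p s = eval_expression p' s' -> p = p' /\ s = s'.
Proof.
elim: s p p' s' => [|[o q] s IH] p p' [|[o' q'] s'] //.
- move=> /all_atoms_head hp /all_atoms_cons[hp' /all_atoms_head hs'].
  rewrite eval_expression_cons => /(atom_op _ _ hp) [] //.
    exact: atom_order.
  exact/order_eval_gt0/atom_order.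
- move=> /all_atoms_cons[hp /all_atoms_head hs] /all_atoms_head hp'.
  rewrite eval_expression_cons => /esym /(atom_op _ _ hp') [] //.
    exact: atom_order.
  exact/order_eval_gt0/atom_order.
move=> /all_atoms_cons[hp hs] /all_atoms_cons[hp' hs'].
rewrite !eval_expression_cons => e.
have p0 := atom_order hp; have p'0 := atom_order hp'.
have q0 := order_eval_gt0 s (atom_order (all_atoms_head hs)).
have q'0 := order_eval_gt0 s' (atom_order (all_atoms_head hs')).
have [lt|lt|eo] := ltngtP (pd_order p) (pd_order p').
- by have [c [c0 /(atom_op _ _ hp')[]]] := op_shift p0 q0 p'0 q'0 e lt.
- by have [c [c0 /(atom_op _ _ hp)[]]] := op_shift p'0 q'0 p0 q0 (esym e) lt.
have [-> -> /IH[] // -> ->] := op_cancel p0 q0 p'0 q'0 e eo.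
by [].
Qed.

(** Expressions are nested to the right, so isolating the product in the middle takes mixed
    associativity. *)
Lemma eval_cat p s o q t : 0 < pd_order p -> 0 < pd_order q ->
    {in unzip2 s, forall a, 0 < pd_order a} ->
  eval_expression p (s ++ (o, q) :: t) =
  pd_op o (eval_expression p s) (eval_expression q t).
Proof.
move=> p0 q0; elim: s p p0 => [|[o' p'] s IH] p p0 hs.
  by rewrite -eval_expression_cons.
have p'0 : 0 < pd_order p' by apply: hs; rewrite inE eqxx.
rewrite cat_cons !eval_expression_cons IH ?op_assoc //.
- exact: order_eval_gt0.
- exact: order_eval_gt0.
- by move=> a ai; apply: hs; rewrite inE ai orbT.
Qed.

Lemma refinement_exists p : p <> pempty -> exists e, is_refinement p e.
Proof.
have [n] := ubnP (pd_order p); elim: n p => // n IH p pn p0.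
have [ap|[o [b [c [b0 c0 e]]]]] := atom_or_op p0.
  by exists (p, [::]); split=> // a; rewrite inE => /eqP ->.
have := congr1 pd_order e; rewrite order_op => eo.
have [||[b1 bs] [hb eb]] := IH b; [lia|exact/pd_order_gt0|].
have [||[c1 cs] [hc ec]] := IH c; [lia|exact/pd_order_gt0|].
rewrite /= in hb eb hc ec.
exists (b1, bs ++ (o, c1) :: cs); split=> /=.
  move=> a; rewrite /unzip2 map_cat -cat_cons mem_cat => /orP[/hb|/hc] //.
rewrite eval_cat -?eb -?ec //.
- by apply: atom_order; apply: hb; rewrite inE eqxx.
- by apply: atom_order; apply: hc; rewrite inE eqxx.
- by move=> a ai; apply: atom_order; apply: hb; rewrite inE ai orbT.
Qed.

Lemma refinement_eval p s : all_atoms p s ->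
  refinement (eval_expression p s) = (p, s).
Proof.
move=> h; apply: classical_sets.xget_unique; first by [].
by move=> [p' s'] [h' /= e]; case: (eval_inj h' h (esym e)) => /= -> ->.
Qed.

Lemma refinementP p : p <> pempty -> is_refinement p (refinement p).
Proof.
case/refinement_exists=> e he.
exact: (classical_sets.xgetPex _ (ex_intro _ e he)).
Qed.

(** An expression in irreducible diagrams has positive order, so [xget] returns its default. The
    empty diagram thus gets the factor list [[:: pempty]], which no other diagram shares. *)
Lemma refinement_pempty : refinement pempty = (pempty, [::]).
Proof.
apply: classical_sets.xgetPN => -[p s] [h /= e].
have := order_eval_gt0 s (atom_order (all_atoms_head h)).
by rewrite -e.
Qed.

Lemma tensor_factorization_inj p s t :
  tensor_factorization p s -> tensor_factorization p t -> s = t.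
Proof.
pose ok (s : seq pdiag) :=
  {in s, forall a, a <> pempty /\ tensor_irreducible a}.
have okc a u : ok (a :: u) -> [/\ 0 < pd_order a, tensor_irreducible a & ok u].
  move=> h; have [/pd_order_gt0 a0 ia] : a <> pempty /\ tensor_irreducible a.
    by apply: h; rewrite inE eqxx.
  by split=> // b bu; apply: h; rewrite inE bu orbT.
have pos a u : ok (a :: u) -> 0 < pd_order (foldr pd_tensor pempty (a :: u)).
  by case/okc=> a0 _ _; rewrite (order_tensor a); lia.
have irr a b c u : tensor_irreducible a -> 0 < pd_order b -> ok (c :: u) ->
    a <> pd_tensor b (foldr pd_tensor pempty (c :: u)).
  move=> ia /pd_order_gt0 b0 /pos /pd_order_gt0 cu e; apply: ia.
  by exists b, (foldr pd_tensor pempty (c :: u)).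
move=> [hs ->] [ht]; move: hs ht; rewrite -/(ok s) -/(ok t).
elim: s t => [|a s IH] [|b t] //.
- by move=> _ /pos + e; rewrite -e.
- by move=> /pos + _ e; rewrite e.
move=> /okc[a0 ia hs] /okc[b0 ib ht] /=.
(* A list of length one ends in the unit [pempty] and is simplified by [tensord0]; only longer lists
   have the non-empty tails that [op_shift] and [op_cancel] require. *)
case: s t IH hs ht => [|a1 s] [|b1 t] IH hs ht.
- by rewrite !tensord0 => ->.
- by rewrite tensord0 => /(irr _ _ _ _ ia b0 ht).
- by rewrite tensord0 => /esym /(irr _ _ _ _ ib a0 hs).
have s0 := pos _ _ hs; have t0 := pos _ _ ht.
move: s0 t0; set x := foldr _ _ (a1 :: s); set y := foldr _ _ (b1 :: t).
move=> x0 y0 e; have e' : pd_op true a x = pd_op true b y by [].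
have [lt|lt|eo] := ltngtP (pd_order a) (pd_order b).
- have [c [/pd_order_gt0 c0 ec _]] := op_shift a0 x0 b0 y0 e' lt.
  by case: ib; exists a, c; split=> //; apply/pd_order_gt0.
- have [c [/pd_order_gt0 c0 ec _]] := op_shift b0 y0 a0 x0 (esym e') lt.
  by case: ia; exists b, c; split=> //; apply/pd_order_gt0.
have [_ -> xy] := op_cancel a0 x0 b0 y0 e' eo.
by rewrite (IH _ hs ht xy).
Qed.

Lemma pd_lenP p s : tensor_factorization p s -> pd_len p = size s.
Proof.
move=> h; rewrite /pd_len; congr size.
apply: (tensor_factorization_inj _ h).
exact: (classical_sets.xgetPex _ (ex_intro _ s h)).
Qed.

(** A tensor splitting would fall inside [a], inside [b], or at the seam, where the product is
    already a bullet product. *)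
Lemma bullet_tensor_irreducible a b : 0 < pd_order a -> 0 < pd_order b ->
    tensor_irreducible a -> tensor_irreducible b ->
  tensor_irreducible (pd_bullet a b).
Proof.
move=> a0 b0 ia ib [x [y [/pd_order_gt0 x0 /pd_order_gt0 y0 e]]].
have {}e : pd_op false a b = pd_op true x y by [].
have [lt|lt|eo] := ltngtP (pd_order a) (pd_order x).
- have [c [c0 _ ec]] := op_shift a0 b0 x0 y0 e lt.
  by apply: ib; exists c, y; split=> //; apply/pd_order_gt0.
- have [c [c0 ec _]] := op_shift x0 y0 a0 b0 (esym e) lt.
  by apply: ia; exists x, c; split=> //; apply/pd_order_gt0.
by have [] := op_cancel a0 b0 x0 y0 e eo.
Qed.

(** Reading from the right, a tensor sign opens a new tensor factor, while a bullet sign absorbs the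
    next irreducible diagram into the leading tensor factor. *)
Lemma pd_len_eval p s : all_atoms p s ->
  pd_len (eval_expression p s) = (count id (unzip1 s)).+1.
Proof.
move=> h; suff [t [ts [hts st]]] : exists t ts,
    tensor_factorization (eval_expression p s) (t :: ts) /\
    size ts = count id (unzip1 s) by rewrite (pd_lenP hts) /= st.
elim: s p h => [|[o q] s IH] p.
  move=> /all_atoms_head[p0 ip _]; exists p, [::]; split=> //; split.
    by move=> a; rewrite inE => /eqP ->.
  by rewrite /= tensord0.
move=> /all_atoms_cons[[p0 ip _] /IH[t [ts [[hts e] st]]]].
rewrite eval_expression_cons e; case: o.
  exists p, (t :: ts); split; last by rewrite /= st.
  by split=> // a; rewrite inE => /orP[/eqP -> //|/hts].
have [t0 it] : t <> pempty /\ tensor_irreducible t.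
  by apply: hts; rewrite inE eqxx.
move/pd_order_gt0: p0 => p0; move/pd_order_gt0: t0 => t0.
exists (pd_bullet p t), ts; split=> //; split=> [a|].
  rewrite inE => /orP[/eqP ->|ats]; last by apply: hts; rewrite inE ats orbT.
  split; last exact: bullet_tensor_irreducible.
  by apply/pd_order_gt0; rewrite order_bullet; lia.
rewrite /=; set u := foldr _ _ ts.
(* Mixed associativity asks for non-empty factors, so an empty rest is treated apart. *)
have [u0|/pd_order_gt0 u0] := boolp.EM (u = pempty).
  by rewrite u0 !tensord0.
exact/esym/(@op_assoc true false).
Qed.

(** * Intervals of the refinement order *)

Definition pd_ops (p : pdiag) : seq bool := unzip1 (refinement p).2.

Lemma refinement_all_atoms p : p <> pempty ->
  all_atoms (refinement p).1 (refinement p).2.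
Proof. by case/refinementP. Qed.

Lemma eval_refinement p :
  eval_expression (refinement p).1 (refinement p).2 = p.
Proof.
have [->|/refinementP[_ <- //]] := boolp.EM (p = pempty).
by rewrite refinement_pempty.
Qed.

Lemma refinementE p : refinement p =
  (head pempty (refinement_factors p),
   zip (pd_ops p) (behead (refinement_factors p))).
Proof. by rewrite /= zip_unzip -surjective_pairing. Qed.

Lemma size_pd_ops p : size (pd_ops p) = (size (refinement_factors p)).-1.
Proof. by rewrite /= !size_map. Qed.

Lemma refinement_factors_pempty p s :
  refinement_factors p = refinement_factors s -> p = pempty -> s = pempty.
Proof.
move=> e p0; apply: boolp.contrapT => /refinementP[/(_ (refinement s).1) + _].
rewrite inE eqxx => /(_ isT) [[]].
by case: e; rewrite p0 refinement_pempty.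
Qed.

Lemma pd_simE p s :
  pd_sim p s = (refinement_factors p == refinement_factors s).
Proof.
rewrite /pd_sim; case: ifP => // /orP ps.
apply/eqP/eqP => [-> //|e]; case: ps => /eqP e0.
  by rewrite e0 (refinement_factors_pempty e).
by rewrite e0 (refinement_factors_pempty (esym e)).
Qed.

(** Positions start at 1 and indices of [pd_ops] at 0; the default [false] answers for indices past
    the end. *)
Lemma mem_tensor_positions p i :
  (i \in tensor_positions p) = (0 < i) && nth false (pd_ops p) i.-1.
Proof.
rewrite mem_filter mem_iota -/(pd_ops p) andbC; case: i => //= i.
rewrite add1n ltnS; case: ltnP => //= si.
by rewrite nth_default.
Qed.

Lemma pd_leP p s : reflect
  (refinement_factors p = refinement_factors s /\
   forall i, nth false (pd_ops s) i -> nth false (pd_ops p) i)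
  (pd_le p s).
Proof.
rewrite /pd_le; case: ifP => [/orP ps|_].
  apply: (iffP eqP) => [-> //|[e _]]; case: ps => /eqP e0.
    by rewrite e0 (refinement_factors_pempty e).
  by rewrite e0 (refinement_factors_pempty (esym e)).
rewrite pd_simE; apply: (iffP andP) => -[/eqP e h]; split=> //.
  move=> i si; move/allP: h => /(_ i.+1).
  by rewrite /= !mem_tensor_positions /= => ->.
apply/allP=> i; rewrite /= !mem_tensor_positions => /andP[-> /=].
exact: h.
Qed.

(** The factor list and the word of products are coordinates on diagrams; the equal factor lists
    force the words to have the same size. *)
Lemma refinement_inj p s : refinement_factors p = refinement_factors s ->
  (forall i, nth false (pd_ops p) i = nth false (pd_ops s) i) -> p = s.
Proof.
move=> e h; have eo : pd_ops p = pd_ops s.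
  by apply: (@eq_from_nth _ false) => [|i _]; rewrite ?size_pd_ops ?e.
by rewrite -(eval_refinement p) -(eval_refinement s) !refinementE e eo.
Qed.

Lemma pd_le_refl : reflexive pd_le.
Proof. by move=> p; apply/pd_leP. Qed.

Lemma pd_le_trans : transitive pd_le.
Proof.
move=> s p t /pd_leP[e h] /pd_leP[e' h']; apply/pd_leP; split.
  by rewrite e.
by move=> i /h'/h.
Qed.

Lemma pd_le_anti : antisymmetric pd_le.
Proof.
move=> p s /andP[/pd_leP[e h] /pd_leP[_ h']]; apply: refinement_inj => // i.
by apply/idP/idP; [apply: h'|apply: h].
Qed.

(** Exchanges the two products at index [i]. Being the identity when there is no such index makes it
    a total involution, as reindexing a sum requires. *)
Definition flip (i : nat) (p : pdiag) : pdiag :=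
  if i < size (pd_ops p) then
    eval_expression (refinement p).1
      (zip (set_nth false (pd_ops p) i (~~ nth false (pd_ops p) i))
           (behead (refinement_factors p)))
  else p.

Section Flip.
Variables (i : nat) (p : pdiag).

Lemma flip_refinement : i < size (pd_ops p) ->
  let s := zip (set_nth false (pd_ops p) i (~~ nth false (pd_ops p) i))
           (behead (refinement_factors p)) in
  [/\ flip i p = eval_expression (refinement p).1 s,
      all_atoms (refinement p).1 s,
      unzip1 s = set_nth false (pd_ops p) i (~~ nth false (pd_ops p) i)
    & unzip2 s = behead (refinement_factors p)].
Proof.
move=> ip; rewrite /flip ip; set w := set_nth _ _ _ _.
have sw : size w = size (behead (refinement_factors p)).
  rewrite size_behead -size_pd_ops size_set_nth; apply/maxn_idPr; exact: ip.
have p0 : p <> pempty.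
  by move=> p0; move: ip; rewrite p0 /pd_ops refinement_pempty.
split=> //; last 2 first.
- by rewrite unzip1_zip ?sw.
- by rewrite unzip2_zip ?sw.
by rewrite /all_atoms unzip2_zip ?sw //; apply: refinement_all_atoms.
Qed.

Lemma order_flip : pd_order (flip i p) = pd_order p.
Proof.
case: (ltnP i (size (pd_ops p))) => [|ip]; last by rewrite /flip ltnNge ip.
case/flip_refinement=> -> _ _; rewrite order_eval => ->.
by rewrite -[in RHS](eval_refinement p) order_eval.
Qed.

Lemma factors_flip : refinement_factors (flip i p) = refinement_factors p.
Proof.
case: (ltnP i (size (pd_ops p))) => [|ip]; last by rewrite /flip ltnNge ip.
by case/flip_refinement=> -> h _ e; rewrite /refinement_factors
  refinement_eval //= e.
Qed.

Lemma ops_flip : i < size (pd_ops p) ->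
  pd_ops (flip i p) =
  set_nth false (pd_ops p) i (~~ nth false (pd_ops p) i).
Proof.
case/flip_refinement=> -> h e _.
by rewrite /pd_ops refinement_eval //= e.
Qed.

Lemma nth_ops_flip j : i < size (pd_ops p) ->
  nth false (pd_ops (flip i p)) j = (i == j) (+) nth false (pd_ops p) j.
Proof.
move=> ip; rewrite ops_flip // nth_set_nth /= eq_sym.
by case: eqP => // ->.
Qed.

(** The length moves by one, up or down; the additive form covers both directions without truncated
    subtraction. *)
Lemma pd_len_flip : i < size (pd_ops p) ->
  pd_len (flip i p) + nth false (pd_ops p) i =
  pd_len p + ~~ nth false (pd_ops p) i.
Proof.
move=> ip.
have p0 : p <> pempty.
  by move=> p0; move: ip; rewrite p0 /pd_ops refinement_pempty.
have lp : pd_len p = (count id (pd_ops p)).+1.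
  rewrite -[in LHS](eval_refinement p) pd_len_eval //.
  exact: refinement_all_atoms.
have [-> /pd_len_eval -> -> _] := flip_refinement ip.
rewrite lp count_set_nth_ltn //=.
(* This bound keeps the subtraction in [count_set_nth_ltn] from truncating. *)
have : nth false (pd_ops p) i <= count id (pd_ops p).
  case: (boolP (nth _ _ _)) => //= n; rewrite -has_count; apply/hasP.
  by exists true => //; rewrite -[true]n mem_nth.
lia.
Qed.

End Flip.

Lemma flipK i : involutive (flip i).
Proof.
move=> p; case: (ltnP i (size (pd_ops p))) => ip.
  apply: refinement_inj => [|j]; first by rewrite !factors_flip.
  by rewrite !nth_ops_flip ?addKb // size_pd_ops factors_flip -size_pd_ops.
by have e : flip i p = p by [rewrite /flip ltnNge ip]; rewrite !e.
Qed.

Local Open Scope ring_scope.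

Lemma Tagged_diagram_inj n :
  injective (fun d : diagram n => Tagged diagram d).
Proof.
move=> d d' e; have := congr1 (tagged_as (Tagged diagram d)) e.
by rewrite !tagged_asE.
Qed.

(** * The signed sum over an interval *)

Section Moebius.
Variable R : comPzRingType.

Lemma sum_flip n i (P : pred pdiag) (F : pdiag -> R) :
  \sum_(d : diagram n | P (Tagged diagram d)) F (Tagged diagram d) =
  \sum_(d : diagram n | P (flip i (Tagged diagram d)))
     F (flip i (Tagged diagram d)).
Proof.
(* [flip] preserves the order only propositionally; [tagged_as] carries the result back to
   [diagram n]. *)
pose h (d : diagram n) : diagram n :=
  tagged_as (Tagged diagram d) (flip i (Tagged diagram d)).
have hE d : Tagged diagram (h d) = flip i (Tagged diagram d).
  rewrite /h; have := order_flip i (Tagged diagram d).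
  case: (flip i _) => m e; rewrite /pd_order /= => mn.
  case: _ / (esym mn) in e *.
  by rewrite tagged_asE.
have hK : involutive h.
  by move=> d; apply: Tagged_diagram_inj; rewrite !hE flipK.
rewrite (reindex_inj (inv_inj hK)).
by apply: eq_big => d; rewrite hE.
Qed.

(** Moebius inversion on a Boolean lattice: for [rho] strictly below [pi], [flip i] pairs terms of
    opposite sign. The exponent is a sum because only the parity of the difference of lengths
    matters. *)
Lemma sum_pd_interval (rho pi : pdiag) :
  \sum_(d : diagram (pd_order rho)
        | pd_le rho (Tagged diagram d) && pd_le (Tagged diagram d) pi)
    (-1) ^+ (pd_len (Tagged diagram d) + pd_len pi)%N = (rho == pi)%:R :> R.
Proof.
case: (boolP (pd_le rho pi)) => [le|nle]; last first.
  rewrite big1 => [|d /andP[h1 h2]]; last by rewrite (pd_le_trans h1 h2) in nle.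
  by case: eqP nle => // ->; rewrite pd_le_refl.
have [<-|ne] := eqVneq rho pi.
  rewrite (big_pred1 (tagged rho)) => [|d /=].
    rewrite (_ : Tagged diagram (tagged rho) = rho); last by case: (rho).
    by rewrite -signr_odd oddD addbb.
  apply/idP/eqP => [/pd_le_anti e|->].
    by apply: Tagged_diagram_inj; rewrite -e; case: (rho).
  by case: (rho) => n d' /=; rewrite pd_le_refl.
have [i ri pi_i] : exists2 i, nth false (pd_ops rho) i
                              & ~~ nth false (pd_ops pi) i.
  apply: boolp.contrapT => h; case/eqP: ne; apply: pd_le_anti; rewrite le /=.
  have /pd_leP[e _] := le; apply/pd_leP; split=> // j rj.
  by apply: boolp.contrapT => /negP nj; apply: h; exists j.
pose P d := pd_le rho d && pd_le d pi.
pose F (d : pdiag) : R := (-1) ^+ (pd_len d + pd_len pi)%N.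
have isz d : P d -> (i < size (pd_ops d))%N.
  case/andP=> /pd_leP[e _] _; rewrite size_pd_ops -e -size_pd_ops.
  by rewrite ltnNge; apply: contraL ri => /(nth_default false) ->.
have Pflip d : (P (flip i d) && ~~ nth false (pd_ops (flip i d)) i) =
               (P d && nth false (pd_ops d) i).
  (* At index [i] the bound [rho] has a tensor product and [pi] a bullet product, so neither
     constrains the product there and the interval is stable under [flip i]. *)
  have half e : P e -> P (flip i e).
    move=> Pe; have ie := isz _ Pe; case/andP: Pe.
    move=> /pd_leP[e1 h1] /pd_leP[e2 h2]; apply/andP.
    split; apply/pd_leP; rewrite factors_flip; split=> // j.
      rewrite nth_ops_flip //; case: eqP => [<- //|_]; exact: h1.
    rewrite nth_ops_flip // => pj; have ij : i != j.
      by apply: contraTneq pj => <-.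
    by rewrite (negPf ij); apply: h2.
  apply/andP/andP => -[Pd]; have Pd' := half _ Pd.
    by rewrite flipK in Pd'; rewrite nth_ops_flip ?isz // eqxx negbK.
  by rewrite nth_ops_flip ?isz // eqxx negbK.
(* Separate the terms by their product at [i] and carry the bullet half onto the tensor half by
   [flip i]; the two then cancel termwise. *)
rewrite (bigID (fun d => nth false (pd_ops (Tagged diagram d)) i)) /=.
rewrite [X in _ + X](sum_flip _ i
  (fun d => P d && ~~ nth false (pd_ops d) i) F) /=.
rewrite (eq_bigl _ _ (fun d => Pflip (Tagged diagram d))).
rewrite -big_split big1 // => d /andP[/isz id ni] /=.
have := pd_len_flip id; rewrite ni addn0 => <-.
by rewrite /F addn1 addSn exprS mulN1r addNr.
Qed.

End Moebius.

(** * Dual bases *)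

Section DualBases.
Variable K : fieldType.
Implicit Types A B : pdiag -> pdiag -> K.

(** Row [p] of the matrix [A], read within the order of [p]. As [ParSym] and [ParQSym] are the same
    type, it serves for both families. *)
Definition graded_comb A (p : pdiag) : ParSym K :=
  \sum_(s : diagram (pd_order p))
    A p (Tagged diagram s) *: pd_H (Tagged diagram s).

(** The equation A B^T = 1 for the square blocks of each order. *)
Definition graded_dual A B : Prop :=
  forall rho pi : pdiag, pd_order rho = pd_order pi ->
  \sum_(s : diagram (pd_order rho))
    A rho (Tagged diagram s) * B pi (Tagged diagram s) = (rho == pi)%:R.

Lemma mcoeff_H (p s : pdiag) : mcoeff p (pd_H s : ParSym K) = (s == p)%:R.
Proof. by rewrite /pd_H mcoeffU. Qed.

Lemma order_Tagged n (d : diagram n) : pd_order (Tagged diagram d) = n.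
Proof. by []. Qed.

Lemma sum_Tagged_eq n (s : pdiag) (F : pdiag -> K) :
  \sum_(d : diagram n)
    F (Tagged diagram d) * (Tagged diagram d == s :> pdiag)%:R =
  if pd_order s == n then F s else 0.
Proof.
case: eqP => [<-|ns].
  rewrite (bigD1 (tagged s)) //= big1 ?addr0 => [|d ds].
    by rewrite (_ : Tagged diagram (tagged s) = s) ?eqxx ?mulr1 //; case: (s).
  case: eqP => [e|]; last by rewrite mulr0.
  case/eqP: ds; apply: Tagged_diagram_inj; rewrite e; by case: (s).
rewrite big1 // => d _; case: eqP => [e|]; last by rewrite mulr0.
by case: ns; rewrite -e.
Qed.

Lemma mcoeff_graded_comb A (p s : pdiag) :
  mcoeff s (graded_comb A p) = if pd_order s == pd_order p then A p s else 0.
Proof.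
rewrite /graded_comb -(sum_Tagged_eq _ _ (A p)) raddf_sum /=.
by apply: eq_bigr => d _; rewrite mcoeffZ mcoeff_H.
Qed.

Lemma pairingC (f h : ParSym K) : pd_pairing f h = pd_pairing h f.
Proof.
pose D := (msupp f `|` msupp h)%fset.
rewrite !(@pairingE _ D) ?fsubsetUl ?fsubsetUr //.
by apply: eq_bigr => p _; rewrite mulrC.
Qed.

Lemma pairing_sumr (I : Type) (r : seq I) (P : pred I) (c : I -> K)
    (g : I -> ParSym K) (f : ParQSym K) :
  pd_pairing f (\sum_(i <- r | P i) c i *: g i) =
  \sum_(i <- r | P i) c i * pd_pairing f (g i).
Proof.
have p0 : pd_pairing f 0 = 0.
  by rewrite /pd_pairing big1 // => p _; rewrite mcoeff0 mulr0.
elim: r => [|i r IH]; first by rewrite !big_nil.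
by rewrite !big_cons; case: ifP => // _; rewrite pairing_linearr IH.
Qed.

Lemma pairing_H (f : ParQSym K) (p : pdiag) :
  pd_pairing f (pd_H p) = mcoeff p f.
Proof.
rewrite pairingC (@pairingE _ [fset p]%fset) ?msuppU_le //.
by rewrite big_seq_fset1 mcoeff_H eqxx mul1r.
Qed.

Lemma graded_dual_sym A B : graded_dual A B -> graded_dual B A.
Proof.
move=> h rho pi e; rewrite eq_sym -h //.
by rewrite /pd_order in e *; case: _ / e; apply: eq_bigr => s _; rewrite mulrC.
Qed.

(** Within one order this is the matrix equation; combinations of different orders have no basis
    element in common. *)
Lemma pairing_graded_comb A B : graded_dual A B ->
  forall rho pi, pd_pairing (graded_comb A rho) (graded_comb B pi) =
                 (rho == pi)%:R.
Proof.
move=> h rho pi; rewrite pairingC pairing_sumr.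
have [e|ne] := eqVneq (pd_order rho) (pd_order pi).
  rewrite -h //; apply: eq_bigr => s _; rewrite pairing_H mcoeff_graded_comb.
  by rewrite order_Tagged (introT eqP e).
rewrite big1 => [|s _]; last first.
  rewrite pairing_H mcoeff_graded_comb order_Tagged.
  by rewrite (negPf ne) mulr0.
by case: (rho =P pi) ne => // ->; rewrite eqxx.
Qed.

(* In each order, a one-sided inverse of a square matrix is two-sided. *)
Lemma graded_dual_transpose A B : graded_dual A B ->
  graded_dual (fun p s => A s p) (fun p s => B s p).
Proof.
move=> h [n x] [n' y]; rewrite /pd_order /= => nn'; subst n'.
pose f (i : 'I_#|{: diagram n}|) : pdiag :=
  Tagged diagram (enum_val i : diagram n).
pose a : 'M_#|{: diagram n}| := \matrix_(i, j) A (f i) (f j).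
pose b : 'M_#|{: diagram n}| := \matrix_(i, j) B (f j) (f i).
have feq i j : (f i == f j) = (i == j).
  apply/eqP/eqP => [/Tagged_diagram_inj /enum_val_inj //|-> //].
(* [b] is transposed, so this is the hypothesis itself; [mulmx1C] then reverses the product. *)
have ab : a *m b = 1%:M.
  apply/matrixP => i j; rewrite !mxE -feq -(h (f i) (f j)) //.
  rewrite (reindex (enum_val : 'I_#|{: diagram n}| -> diagram n)) /=.
    by apply: eq_bigr => k _; rewrite !mxE.
  by apply: onW_bij; apply: enum_val_bij.
have /matrixP/(_ (enum_rank y) (enum_rank x)) := mulmx1C ab.
rewrite !mxE -feq /f !enum_rankK eq_sym => <-.
rewrite (reindex (enum_val : 'I_#|{: diagram n}| -> diagram n)) /=.
  by apply: eq_bigr => k _; rewrite !mxE /f !enum_rankK mulrC.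
by apply: onW_bij; apply: enum_val_bij.
Qed.

(** Comparing coefficients at [q] leaves the transposed duality B^T A = 1. *)
Lemma graded_comb_inv A B (p : pdiag) : graded_dual A B ->
  \sum_(s : diagram (pd_order p))
     B (Tagged diagram s) p *: graded_comb A (Tagged diagram s) = pd_H p.
Proof.
move=> /graded_dual_transpose h; apply/malgP => q.
rewrite mcoeff_H raddf_sum /=.
under eq_bigr => s _ do rewrite mcoeffZ mcoeff_graded_comb.
have [e|ne] := eqVneq (pd_order q) (pd_order p).
  rewrite eq_sym -h // e; apply: eq_bigr => s _.
  by rewrite mulrC.
rewrite big1 => [|s _]; last by rewrite mulr0.
by case: (p =P q) ne => // ->; rewrite eqxx.
Qed.

(** Pairing with the dual family isolates each coefficient, which gives independence; the inverse
    matrix expresses every [pd_H p], which gives generation. *)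
Lemma graded_comb_basis A B : graded_dual A B -> is_basis (graded_comb A).
Proof.
move=> h; split.
  move=> s c us e i si.
  have := congr1 (pd_pairing (graded_comb B i)) e; rewrite pairing_sumr.
  rewrite (bigD1_seq i) //= pairing_graded_comb; last exact: graded_dual_sym.
  rewrite eqxx mulr1 big1 => [|j ji]; last first.
    rewrite pairing_graded_comb; last exact: graded_dual_sym.
    by rewrite eq_sym (negPf ji) mulr0.
  rewrite addr0 => ->.
  by rewrite /pd_pairing big1 // => p _; rewrite mcoeff0 mulr0.
(* [N] exceeds every order in the support of [v], so [s] contains every diagram needed; the
   coefficients are read off by pairing [v] with the dual family. *)
move=> v; pose N := (\max_(p <- msupp v) pd_order p).+1.
pose s : seq pdiag :=
  [seq Tagged diagram d | n <- iota 0 N, d <- index_enum (diagram n)].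
pose c (i : pdiag) : K := pd_pairing v (graded_comb B i).
exists s, c.
have cE (i : pdiag) : c i =
    \sum_(p <- msupp v) v@_p * (if pd_order p == pd_order i then B i p else 0).
  by apply: eq_bigr => p _; rewrite mcoeff_graded_comb.
have sE p : p \in msupp v ->
    \sum_(i <- s) (if pd_order p == pd_order i then B i p else 0)
       *: graded_comb A i = pd_H p.
  move=> pv; have pN : (pd_order p < N)%N by rewrite ltnS leq_bigmax_seq.
  rewrite big_allpairs_dep (bigD1_seq (pd_order p)) ?iota_uniq ?mem_iota //=.
  rewrite [X in _ + X]big1 ?addr0 => [|n np].
    rewrite -(graded_comb_inv p h); apply: eq_bigr => d _.
    by rewrite eqxx.
  rewrite big1 // => d _.
  by rewrite eq_sym (negPf np) scale0r.
rewrite [LHS]monalgE; transitivity (\sum_(p <- msupp v) v@_p *: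
   \sum_(i <- s) (if pd_order p == pd_order i then B i p else 0)
       *: graded_comb A i).
  rewrite big_seq [RHS]big_seq; apply: eq_bigr => p pv.
  by rewrite sE // /pd_H; apply/malgP => q; rewrite mcoeffZ !mcoeffU -mulr_natr.
under eq_bigr => p _ do rewrite scaler_sumr.
rewrite exchange_big /=; apply: eq_bigr => i _.
rewrite cE scaler_suml; apply: eq_bigr => p _.
by rewrite scalerA.
Qed.

End DualBases.

Theorem proposition9p4 (K : fieldType) (r q : K)
    (hr : r \is a GRing.unit) (hq : q = r - 1) :
  [/\ is_basis (pd_eta q), is_basis (pd_kappa q)
    & forall rho pi : pdiag,
        pd_pairing (pd_eta q rho) (pd_kappa q pi) = (rho == pi)%:R].
Proof.
have r0 : r != 0 by rewrite -unitfE.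
have qr : q + 1 = r by rewrite hq subrK.
pose A (p s : pdiag) : K := if pd_le p s then r ^+ pd_len s else 0.
pose B (p s : pdiag) : K := if pd_le s p then
  (-1) ^+ (pd_len s + pd_len p) * r ^- pd_len s else 0.
have eA : pd_eta q = graded_comb A.
  apply: boolp.funext => p; rewrite /pd_eta /graded_comb qr big_mkcond /=.
  by apply: eq_bigr => s _; rewrite /A; case: ifP; rewrite ?scale0r.
(* The integer a - b and the natural number a + b have the same parity. *)
have sgn (a b : nat) : (-1) ^ (a%:Z - b%:Z) = (-1) ^+ (a + b) :> K.
  by rewrite expfzDr ?oppr_eq0 ?oner_eq0 //
    -invr_expz -!exprnP -exprVn invrN1 exprD.
have eB : pd_kappa q = graded_comb B.
  apply: boolp.funext => p; rewrite /pd_kappa /graded_comb qr big_mkcond /=.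
  by apply: eq_bigr => s _; rewrite /B; case: ifP; rewrite ?scale0r ?sgn.
have dual : graded_dual A B.
  (* The powers of [r] cancel in each term, leaving the signed sum over the interval from [rho] to
     [pi]. *)
  move=> rho pi _; rewrite -(sum_pd_interval K) [RHS]big_mkcond /=.
  apply: eq_bigr => s _; rewrite /A /B.
  do 2 case: ifP => _ /=; rewrite ?mul0r ?mulr0 //.
  by rewrite mulrCA divff ?mulr1 // expf_neq0.
rewrite eA eB; split.
- exact: graded_comb_basis dual.
- exact: graded_comb_basis (graded_dual_sym dual).
- exact: pairing_graded_comb.
Qed.
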